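(* Let ${\sf Compl}$ be the following formula about a countable bounded partial order $P$ (with top $\top$ and bottom $\bot$), expressing that every element has a complement: $$\forall a\in P\ \exists b\in P\ \forall c\in P\ \ \neg\big[(a,b\le_P c<_P\top)\ \vee\ (\bot<_P c\le_P a,b)\big].$$ Then ${\sf Compl}$ is $\forall\exists\forall$-dicomplete.
   Context: Quantifiers range over $\omega$. $\exists^\infty n\,\varphi(n)$ means $\forall m\exists n\ge m\,\varphi(n)$ and $\forall^\infty n\,\varphi(n)$ means $\exists m\forall n\ge m\,\varphi(n)$. A quantifier-pattern is a finite string $\bar{\mathsf Q}=\mathsf Q_0\dots\mathsf Q_\ell$ over $\{\exists,\forall,\exists^\infty,\forall^\infty\}$. A $\bar{\mathsf Q}$-formula is $\varphi(\bar x)\equiv\mathsf Q_0n_0\dots\mathsf Q_\ell n_\ell\,\theta(n_0,\dots,n_\ell,\bar x)$ with $\theta$ a bounded formula. The instance $\bar x$ is a tuple of natural numbers and/or total computable functions (computable elements of $\omega^\omega$). Spaces such as $\omega\times\omega^\omega$, $(\omega^\omega)^\omega$, $\omega^{\omega\times\omega}$ are identified with $\omega^\omega$ by computable pairing. Witnesses: for $\alpha\in\omega^\omega$, $\alpha\Vdash\varphi(\bar x)$ (''$\alpha$ is a witness for $\varphi(\bar x)$'') is defined by: $\alpha\Vdash\theta(\bar x)$ iff $\alpha=\bar x$ and $\theta(\bar x)$, for bounded $\theta$; $\langle t,\alpha\rangle\Vdash\exists n\varphi(n,\bar x)$ iff $\alpha\Vdash\varphi(t,\bar x)$; $\alpha\Vdash\forall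 n\varphi(n,\bar x)$ iff $\alpha(n)\Vdash\varphi(n,\bar x)$ for all $n$; $\langle t,\alpha\rangle\Vdash\forall^\infty n\varphi(n,\bar x)$ iff $\alpha(n)\Vdash\varphi(n,\bar x)$ for all $n\ge t$; $\alpha\Vdash\exists^\infty n\varphi(n,\bar x)$ iff for all $n$, writing $\alpha(n)=\langle k,\beta\rangle$, $k\ge n$ and $\beta\Vdash\varphi(k,\bar x)$. Reducibility: $\varphi\le_{\sf m}\psi$ if there are computable functions $\eta,r_-,r_+$ (type-two computable functionals, possibly partial but defined wherever required) such that for every instance $\bar x$: $\varphi(\bar x)$ is true iff $\psi(\eta(\bar x))$ is true; $\alpha\Vdash\varphi(\bar x)$ implies $r_-(\alpha,\bar x)\Vdash\psi(\eta(\bar x))$; $\alpha\Vdash\psi(\eta(\bar x))$ implies $r_+(\alpha,\bar x)\Vdash\varphi(\bar x)$ ($\alpha\in\omega^\omega$ arbitrary). The dual $\varphi^{\sf d}$ of $\mathsf Q_0n_0\dots\mathsf Q_\ell n_\ell\,\theta$ is $\mathsf Q_0^{\sf d}n_0\dots\mathsf Q_\ell^{\sf d}n_\ell\,\neg\theta$, where $\exists^{\sf d}=\forall$, $\forall^{\sf d}=\exists$, $(\exists^\infty)^{\sf d}=\forall^\infty$, $(\forall^\infty)^{\sf d}=\exists^\infty$. $\varphi\le_{\sf dm}\psi$ if $\varphi\le_{\sf m}\psi$ and $\varphi^{\sf d}\le_{\sf m}\psi^{\sf d}$ via a common $\eta$ (the $r_\pm$ may differ). $\varphi$ is strictly $\bar{\mathsf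 Q}$-dicomplete if it is a $\bar{\mathsf Q}$-formula and $\psi\le_{\sf dm}\varphi$ for every $\bar{\mathsf Q}$-formula $\psi$; it is $\bar{\mathsf Q}$-dicomplete if it is $\equiv_{\sf dm}$-equivalent to a strictly $\bar{\mathsf Q}$-dicomplete formula (one such is $\mathsf Q_0n_0\dots\mathsf Q_\ell n_\ell.\ x(n_0,\dots,n_\ell)=0$). Structures: a countable binary relation $(X,R)$, $X\subseteq\omega$, $R\subseteq X^2$, is coded by the pair of characteristic functions of $X$ and $R$, and is identified with its code; here the instance is a (computable) code of a bounded partial order $P$ together with its elements $\top,\bot$. Reductions from the problem need only work on such instances and reductions to it must output such instances. Restricted quantifiers mean $\forall a(a\in P\to\cdots)$, $\exists b(b\in P\wedge\cdots)$, with these decidable conditions moved into the innermost bounded part. *)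

(* Defs.v *)
From mathcomp Require Import all_boot.
From Stdlib Require Cantor.

Set Implicit Arguments.
Unset Strict Implicit.
Unset Printing Implicit Defensive.

(** * Codings *)

Definition pr (a b : nat) : nat := Cantor.to_nat (a, b).

(* The identification of [nat * (nat -> nat)] with [nat -> nat]: the pair
   <t, a> is the sequence t, a 0, a 1, ...  Every sequence is such a pair,
   namely <a 0, tl a>. *)
Definition consf (t : nat) (a : nat -> nat) : nat -> nat :=
  fun n => if n is m.+1 then a m else t.
Definition tl (a : nat -> nat) : nat -> nat := fun n => a n.+1.

(* The identification of [nat -> nat] with sequences of functions: [col a n]
   is the n-th function coded by [a]. *)
Definition col (a : nat -> nat) (n : nat) : nat -> nat := fun m => a (pr n m).

Definition zerof : nat -> nat := fun=> 0.

Definition joinf (fs : seq (nat -> nat)) : nat -> nat :=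
  fun k => let: (i, m) := Cantor.of_nat k in nth zerof fs i m.

(* A tuple of numbers [nums] followed by functions [funs], and its code as a
   single element of [nat -> nat]. *)
Record tuple_ := Tuple_ { nums : seq nat; funs : seq (nat -> nat) }.

Definition code (x : tuple_) : nat -> nat := foldr consf (joinf (funs x)) (nums x).

(** * Type-two computability *)

(* Partial recursive functionals with number arguments (a de Bruijn
   environment) and oracles.  [PLet p q] binds the value of [p] as variable 0
   of [q]; it provides composition. *)
Inductive prog :=
| PVar of nat
| PZero
| PSucc of prog
| POracle of nat & prog
| PLet of prog & prog
| PRec of prog & prog & prog
| PMu of prog.

(* [eval p o env v]: program [p], with oracles [o], halts on the arguments
   [env] with value [v].
   [PRec p q s] iterates [s] as many times as the value of [p], starting from
   the value of [q]; in [s], variable 0 is the previous value and variable 1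
   the number of steps already done.
   [PMu p] is the least [v] at which [p] vanishes, [p] being defined below [v]
   (variable 0 of [p] is the candidate). *)
Fixpoint eval (p : prog) (o : seq (nat -> nat)) (env : seq nat) (v : nat)
    {struct p} : Prop :=
  match p with
  | PVar i => v = nth 0 env i
  | PZero => v = 0
  | PSucc p => exists2 w, eval p o env w & v = w.+1
  | POracle i p => exists2 w, eval p o env w & v = nth zerof o i w
  | PLet p q => exists2 w, eval p o env w & eval q o (w :: env) v
  | PRec p q s =>
      exists2 k, eval p o env k &
      exists u : nat -> nat,
        [/\ eval q o env (u 0),
            forall i, i < k -> eval s o [:: u i, i & env] (u i.+1)
          & v = u k]
  | PMu p =>
      eval p o (v :: env) 0 /\
      forall j, j < v -> exists w, eval p o (j :: env) w.+1
  end.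

(* [p], with oracles [o] and parameters [ns], computes the function [f]. *)
Definition computes (p : prog) (o : seq (nat -> nat)) (ns : seq nat)
    (f : nat -> nat) : Prop :=
  forall n, eval p o (n :: ns) (f n).

Definition computable (f : nat -> nat) : Prop :=
  exists p, computes p [::] [::] f.

(* [eta] is (the restriction to [D] of) a partial computable functional
   between tuples of numbers and functions: each output component is computed
   by one program, uniformly in the input tuple. *)
Definition computable_on (D : tuple_ -> Prop) (eta : tuple_ -> tuple_) : Prop :=
  exists ps qs : seq prog, forall x, D x ->
    [/\ size (nums (eta x)) = size ps,
        size (funs (eta x)) = size qs,
        forall i, i < size ps ->
          eval (nth PZero ps i) (funs x) (nums x) (nth 0 (nums (eta x)) i)
      & forall i, i < size qs ->
          computes (nth PZero qs i) (funs x) (nums x)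
                   (nth zerof (funs (eta x)) i)].

(** * Bounded formulas *)

(* Arithmetic with function variables.  The Cantor pairing is included as a
   function symbol (its graph is bounded-definable) so that function variables
   can be read as functions on pairs. *)
Inductive term :=
| TVar of nat
| TApp of nat & term
| TZero
| TSucc of term
| TAdd of term & term
| TMul of term & term
| TPair of term & term.

(* The bounded quantifiers [BAll t A] and [BEx t A] range over k < t; inside
   [A], k is number variable 0 and the other number variables are shifted. *)
Inductive bform :=
| BEq of term & term
| BLe of term & term
| BNot of bform
| BAnd of bform & bform
| BOr of bform & bform
| BImp of bform & bform
| BAll of term & bform
| BEx of term & bform.

Fixpoint teval (ns : seq nat) (fs : seq (nat -> nat)) (t : term) : nat :=
  match t with
  | TVar i => nth 0 ns i
  | TApp i t => nth zerof fs i (teval ns fs t)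
  | TZero => 0
  | TSucc t => (teval ns fs t).+1
  | TAdd s t => teval ns fs s + teval ns fs t
  | TMul s t => teval ns fs s * teval ns fs t
  | TPair s t => pr (teval ns fs s) (teval ns fs t)
  end.

Fixpoint sat (ns : seq nat) (fs : seq (nat -> nat)) (A : bform) : bool :=
  match A with
  | BEq s t => teval ns fs s == teval ns fs t
  | BLe s t => teval ns fs s <= teval ns fs t
  | BNot A => ~~ sat ns fs A
  | BAnd A B => sat ns fs A && sat ns fs B
  | BOr A B => sat ns fs A || sat ns fs B
  | BImp A B => sat ns fs A ==> sat ns fs B
  | BAll t A => all (fun k => sat (k :: ns) fs A) (iota 0 (teval ns fs t))
  | BEx t A => has (fun k => sat (k :: ns) fs A) (iota 0 (teval ns fs t))
  end.

(** * Formulas with a quantifier pattern, truth and witnesses *)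

Inductive quant := QEx | QAll | QExInf | QAllInf.

(* The formula Q_0 n_0 ... Q_l n_l theta(n_0, ..., n_l, x), where x is a tuple
   of [nnums] numbers and [nfuns] functions.  In [matrix], the number variables
   are n_0, ..., n_l followed by the numbers of x. *)
Record formula := Formula {
  pattern : seq quant;
  nnums : nat;
  nfuns : nat;
  matrix : bform
}.

Fixpoint holds_rec (Q : seq quant) (A : bform) (ns : seq nat) (x : tuple_)
    : Prop :=
  match Q with
  | [::] => sat (ns ++ nums x) (funs x) A
  | QEx :: Q => exists n, holds_rec Q A (rcons ns n) x
  | QAll :: Q => forall n, holds_rec Q A (rcons ns n) x
  | QExInf :: Q => forall m, exists2 n, m <= n & holds_rec Q A (rcons ns n) x
  | QAllInf :: Q => exists m, forall n, m <= n -> holds_rec Q A (rcons ns n) x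
  end.

Definition holds (phi : formula) (x : tuple_) : Prop :=
  holds_rec (pattern phi) (matrix phi) [::] x.

Fixpoint wit_rec (Q : seq quant) (A : bform) (ns : seq nat) (x : tuple_)
    (a : nat -> nat) : Prop :=
  match Q with
  | [::] => a =1 code (Tuple_ (ns ++ nums x) (funs x)) /\
            sat (ns ++ nums x) (funs x) A
  | QEx :: Q => wit_rec Q A (rcons ns (a 0)) x (tl a)
  | QAll :: Q => forall n, wit_rec Q A (rcons ns n) x (col a n)
  | QExInf :: Q => forall n, n <= col a n 0 /\
                     wit_rec Q A (rcons ns (col a n 0)) x (tl (col a n))
  | QAllInf :: Q => forall n, a 0 <= n ->
                     wit_rec Q A (rcons ns n) x (col (tl a) n)
  end.

Definition witness (phi : formula) (x : tuple_) (a : nat -> nat) : Prop :=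
  wit_rec (pattern phi) (matrix phi) [::] x a.

Definition dualq (q : quant) : quant :=
  match q with
  | QEx => QAll | QAll => QEx | QExInf => QAllInf | QAllInf => QExInf
  end.

Definition dual (phi : formula) : formula :=
  Formula (map dualq (pattern phi)) (nnums phi) (nfuns phi) (BNot (matrix phi)).

(** * Problems: formulas considered on restricted instances *)

Record problem := Problem {
  form :> formula;
  promise : tuple_ -> Prop
}.

Definition instance_of (P : problem) (x : tuple_) : Prop :=
  [/\ size (nums x) = nnums P,
      size (funs x) = nfuns P,
      forall i, i < nfuns P -> computable (nth zerof (funs x) i)
    & promise P x].

Definition unrestricted (phi : formula) : problem := Problem phi (fun=> True).

Definition dualp (P : problem) : problem := Problem (dual P) (promise P).

(** * Reducibilities *)

(* The functionals r_- and r_+ are given by programs using the witness as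
   oracle 0 and the functions of the instance as the following oracles. *)
Definition m_reduction (P R : problem) (eta : tuple_ -> tuple_) : Prop :=
  [/\ forall x, instance_of P x -> instance_of R (eta x),
      forall x, instance_of P x -> (holds P x <-> holds R (eta x)),
      exists rminus : prog, forall x a, instance_of P x -> witness P x a ->
        exists2 b, computes rminus (a :: funs x) (nums x) b &
                   witness R (eta x) b
    & exists rplus : prog, forall x a, instance_of P x -> witness R (eta x) a ->
        exists2 b, computes rplus (a :: funs x) (nums x) b &
                   witness P x b].

Definition le_m (P R : problem) : Prop :=
  exists2 eta, computable_on (instance_of P) eta & m_reduction P R eta.

Definition le_dm (P R : problem) : Prop :=
  exists2 eta, computable_on (instance_of P) eta &
    m_reduction P R eta /\ m_reduction (dualp P) (dualp R) eta.

Definition equiv_dm (P R : problem) : Prop := le_dm P R /\ le_dm R P.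

Definition strictly_dicomplete (Q : seq quant) (phi : formula) : Prop :=
  pattern phi = Q /\
  forall psi : formula, pattern psi = Q ->
    le_dm (unrestricted psi) (unrestricted phi).

Definition dicomplete (Q : seq quant) (P : problem) : Prop :=
  exists2 phi, strictly_dicomplete Q phi & equiv_dm P (unrestricted phi).

(** * Complementedness of bounded partial orders *)

(* [X] and [R] are the characteristic functions of the carrier and of the order
   relation, the latter as a function of coded pairs. *)
Record bounded_poset (top bot : nat) (X R : nat -> nat) : Prop := BoundedPoset {
  bp_charX : forall n, X n <= 1;
  bp_charR : forall n, R n <= 1;
  bp_dom   : forall a b, R (pr a b) = 1 -> X a = 1 /\ X b = 1;
  bp_refl  : forall a, X a = 1 -> R (pr a a) = 1;
  bp_anti  : forall a b, R (pr a b) = 1 -> R (pr b a) = 1 -> a = b;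
  bp_trans : forall a b c, R (pr a b) = 1 -> R (pr b c) = 1 -> R (pr a c) = 1;
  bp_topX  : X top = 1;
  bp_botX  : X bot = 1;
  bp_top   : forall a, X a = 1 -> R (pr a top) = 1;
  bp_bot   : forall a, X a = 1 -> R (pr bot a) = 1
}.

Definition bounded_poset_code (x : tuple_) : Prop :=
  match x with
  | Tuple_ [:: top; bot] [:: X; R] => bounded_poset top bot X R
  | _ => False
  end.

Definition BinP (t : term) : bform := BEq (TApp 0 t) (TSucc TZero).
Definition Ble (s t : term) : bform := BEq (TApp 1 (TPair s t)) (TSucc TZero).
Definition Blt (s t : term) : bform := BAnd (Ble s t) (BNot (BEq s t)).

Definition compl_matrix : bform :=
  let a := TVar 0 in let b := TVar 1 in let c := TVar 2 in
  let top := TVar 3 in let bot := TVar 4 in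
  BImp (BinP a) (BAnd (BinP b) (BImp (BinP c) (BNot
    (BOr (BAnd (BAnd (Ble a c) (Ble b c)) (Blt c top))
         (BAnd (Blt bot c) (BAnd (Ble c a) (Ble c b))))))).

Definition Compl : problem :=
  Problem (Formula [:: QAll; QEx; QAll] 2 2 compl_matrix) bounded_poset_code.

(* Main.v *)
Require Import Defs.
From mathcomp Require Import all_boot.
From mathcomp Require Import zify.
From Stdlib Require Import IndefiniteDescription.
From Stdlib Require Cantor.

(** A witness for a [forall exists forall]-formula amounts to a Skolem function
    [n |-> m], and a witness for its dual to a number [n] with a function
    [m |-> k]; so reductions need only transform Skolem functions. The formula
    "for all n there is m such that for all k, x(n,m,k) = 0" is strictly
    dicomplete, because bounded formulas are uniformly decidable in their
    parameters. It reduces to [Compl] by the following poset. Apart from top and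
    bottom, its elements are coatoms E and F, atoms G below E and H below F,
    elements A_n below E and F, coatoms B_{n,m} above A_{n'} for n' distinct
    from n, and, exactly when x(n,m,k) is nonzero, an element C_{n,m,k} below
    A_n and B_{n,m}. Then E-H, F-G, B_{n,m}-G and C_{n,m,k}-B_{n,m+1} are
    complementary pairs whatever x is. The only possible complements of A_n are
    the B_{n,m}, and B_{n,m} is one iff x(n,m,k) = 0 for all k; otherwise a
    common lower bound C_{n,m,k} gives away a suitable k. *)

Set Implicit Arguments.
Unset Strict Implicit.
Unset Printing Implicit Defensive.

(** * Uniformly computable functionals *)

Definition functional := seq (nat -> nat) -> seq nat -> nat.

(** Totality on all oracles and environments, with default values out of range, keeps every closure
    property below free of side conditions on domains. *)
Definition ucomp (F : functional) := exists p, forall o e, eval p o e (F o e).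

Lemma ucomp_ext (F F' : functional) : ucomp F -> (forall o e, F o e = F' o e) -> ucomp F'.
Proof. by case=> p Hp E; exists p => o e; rewrite -E. Qed.

Definition up (r : nat -> nat) (i : nat) := if i is j.+1 then (r j).+1 else 0.

Fixpoint rename (rho r : nat -> nat) (p : prog) : prog :=
  match p with
  | PVar i => PVar (r i)
  | PZero => PZero
  | PSucc p => PSucc (rename rho r p)
  | POracle i p => POracle (rho i) (rename rho r p)
  | PLet p q => PLet (rename rho r p) (rename rho (up r) q)
  | PRec p q s =>
      PRec (rename rho r p) (rename rho r q) (rename rho (up (up r)) s)
  | PMu p => PMu (rename rho (up r) p)
  end.

Lemma eval_rename rho p o o' : (forall i w, nth zerof o i w = nth zerof o' (rho i) w) ->
  forall r e e' v, (forall i, nth 0 e i = nth 0 e' (r i)) ->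
  eval p o e v -> eval (rename rho r p) o' e' v.
Proof.
move=> Ho; elim: p => [i||p IH|i p IH|p IHp q IHq|p IHp q IHq s IHs|p IH] r e e' v He /=.
- by rewrite He.
- by [].
- by case=> w /IH Hw ->; exists w => //; apply: Hw.
- by case=> w /IH Hw ->; exists w; [apply: Hw | rewrite Ho].
- by case=> w /IHp Hw /IHq Hv; exists w; [apply: Hw | apply: Hv; case].
- case=> k /IHp Hk [u [/IHq H0 HS ->]]; exists k; first exact: Hk.
  exists u; split=> //; first exact: H0.
  by move=> i /HS/IHs; apply; case=> [|[]].
- case=> /IH H0 Hj; split; first by apply: H0; case.
  by move=> j /Hj[w /IH Hw]; exists w; apply: Hw; case.
Qed.

(** Weakening, skipping and reordering of arguments all come from here: a rearrangement described by
    an index map is absorbed into the program. Default values make the index maps correct beyond the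
    end of the lists as well. *)
Lemma ucomp_rename (F : functional) rho r Go Ge : ucomp F ->
  (forall o i w, nth zerof (Go o) i w = nth zerof o (rho i) w) ->
  (forall e i, nth 0 (Ge e) i = nth 0 e (r i)) ->
  ucomp (fun o e => F (Go o) (Ge e)).
Proof.
case=> p Hp Ho He; exists (rename rho r p) => o e.
exact: eval_rename (Ho o) _ _ _ _ (He e) (Hp _ _).
Qed.

Lemma ucomp_behead (F : functional) : ucomp F -> ucomp (fun o e => F o (behead e)).
Proof.
by move=> Hp; apply: (@ucomp_rename F id succn id behead) => // e i; rewrite nth_behead.
Qed.

Lemma ucomp_obehead (F : functional) : ucomp F -> ucomp (fun o e => F (behead o) e).
Proof.
by move=> Hp; apply: (@ucomp_rename F succn id behead id) => // o i w; rewrite nth_behead.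
Qed.

Lemma ucomp_let (F N : functional) : ucomp F -> ucomp N -> ucomp (fun o e => F o (N o e :: e)).
Proof. by case=> p Hp [q Hq]; exists (PLet q p) => o e; exists (N o e). Qed.

Lemma ucomp_skip1 (F : functional) : ucomp F ->
  ucomp (fun o e => F o (nth 0 e 0 :: behead (behead e))).
Proof.
move=> HF; pose Ge e := nth 0 e 0 :: behead (behead e).
apply: (@ucomp_rename F id (fun i => if i is j.+1 then j.+2 else 0) id Ge) => //.
by move=> e [|i] //=; rewrite !nth_behead.
Qed.

(** Composition in the first argument with the parameters kept: [PLet] pushes the new value, and the
    old variable 0, now in position 1, is skipped. *)
Lemma ucomp_call (F N : functional) : ucomp F -> ucomp N ->
  ucomp (fun o e => F o (N o e :: behead e)).
Proof. by move=> HF HN; apply: (ucomp_let (ucomp_skip1 HF) HN). Qed.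

Lemma ucomp_var i : ucomp (fun o e => nth 0 e i).
Proof. by exists (PVar i). Qed.

Lemma ucomp_succ (F : functional) : ucomp F -> ucomp (fun o e => (F o e).+1).
Proof. by case=> p Hp; exists (PSucc p) => o e; exists (F o e). Qed.

Lemma ucomp_const c : ucomp (fun o e => c).
Proof. by elim: c => [|c]; [exists PZero | apply: ucomp_succ]. Qed.

Lemma ucomp_oracle i (F : functional) : ucomp F -> ucomp (fun o e => nth zerof o i (F o e)).
Proof. by case=> p Hp; exists (POracle i p) => o e; exists (F o e). Qed.

Lemma ucomp_rec (N I S : functional) : ucomp N -> ucomp I -> ucomp S ->
  ucomp (fun o e => nat_rect (fun=> nat) (I o e) (fun i y => S o [:: y, i & e]) (N o e)).
Proof.
case=> p Hp [q Hq] [s Hs]; exists (PRec p q s) => o e /=.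
exists (N o e) => //.
by exists (nat_rect (fun=> nat) (I o e) (fun i y => S o [:: y, i & e])).
Qed.

Lemma ucomp_mu (F M : functional) : ucomp F ->
  (forall o e, F o (M o e :: e) = 0) ->
  (forall o e j, j < M o e -> F o (j :: e) != 0) -> ucomp M.
Proof.
case=> p Hp H0 HS; exists (PMu p) => o e; split=> [|j /HS].
  by have := Hp o (M o e :: e); rewrite H0.
by rewrite -lt0n => /prednK E; exists (F o (j :: e)).-1; rewrite E.
Qed.

(** Primitive recursion whose step ignores the previous value is a case distinction: the number of
    the last step is the predecessor. *)
Lemma ucomp_case (N F0 F1 : functional) : ucomp N -> ucomp F0 -> ucomp F1 ->
  ucomp (fun o e => if N o e is k.+1 then F1 o (k :: e) else F0 o e).
Proof.
move=> HN H0 H1; apply: (ucomp_ext (ucomp_rec HN H0 (ucomp_behead H1))) => o e /=.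
by case: (N o e).
Qed.

Lemma ucomp_pred (N : functional) : ucomp N -> ucomp (fun o e => (N o e).-1).
Proof.
move=> HN; apply: (ucomp_ext (ucomp_case HN (ucomp_const 0) (ucomp_var 0))) => o e.
by case: (N o e).
Qed.

Lemma ucomp_add (F G : functional) : ucomp F -> ucomp G -> ucomp (fun o e => F o e + G o e).
Proof.
move=> HF HG; apply: (ucomp_ext (ucomp_rec HG HF (ucomp_succ (ucomp_var 0)))) => o e /=.
by elim: (G o e) => [|n /= ->]; rewrite ?addn0 ?addnS.
Qed.

Lemma ucomp_mul (F G : functional) : ucomp F -> ucomp G -> ucomp (fun o e => F o e * G o e).
Proof.
move=> HF HG.
have HS := ucomp_add (ucomp_behead (ucomp_behead HF)) (ucomp_var 0).
apply: (ucomp_ext (ucomp_rec HG (ucomp_const 0) HS)) => o e /=.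
by elim: (G o e) => [|n /= ->]; rewrite ?muln0 ?mulnS.
Qed.

Lemma ucomp_sub (F G : functional) : ucomp F -> ucomp G -> ucomp (fun o e => F o e - G o e).
Proof.
move=> HF HG; apply: (ucomp_ext (ucomp_rec HG HF (ucomp_pred (ucomp_var 0)))) => o e /=.
by elim: (G o e) => [|n /= ->]; rewrite ?subn0 ?subnS.
Qed.

Lemma ucomp_eq0 (F : functional) : ucomp F -> ucomp (fun o e => F o e == 0).
Proof.
move=> HF; apply: (ucomp_ext (ucomp_case HF (ucomp_const 1) (ucomp_const 0))) => o e.
by case: (F o e).
Qed.

Lemma ucomp_not (F : seq (nat -> nat) -> seq nat -> bool) : ucomp F -> ucomp (fun o e => ~~ F o e).
Proof. by move/ucomp_eq0/ucomp_ext; apply=> o e; case: (F o e). Qed.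

Lemma ucomp_and (F G : seq (nat -> nat) -> seq nat -> bool) :
  ucomp F -> ucomp G -> ucomp (fun o e => F o e && G o e).
Proof. by move=> HF HG; apply: (ucomp_ext (ucomp_mul HF HG)) => o e; rewrite mulnb. Qed.

Lemma ucomp_or (F G : seq (nat -> nat) -> seq nat -> bool) :
  ucomp F -> ucomp G -> ucomp (fun o e => F o e || G o e).
Proof.
move=> HF HG; apply: (ucomp_ext (ucomp_not (ucomp_and (ucomp_not HF) (ucomp_not HG)))) => o e.
by case: (F o e) (G o e) => [] [].
Qed.

Lemma ucomp_leq (F G : functional) : ucomp F -> ucomp G -> ucomp (fun o e => F o e <= G o e).
Proof. by move=> HF HG; apply: ucomp_eq0 (ucomp_sub HF HG). Qed.

Lemma ucomp_eq (F G : functional) : ucomp F -> ucomp G -> ucomp (fun o e => F o e == G o e).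
Proof.
move=> HF HG; apply: (ucomp_ext (ucomp_and (ucomp_leq HF HG) (ucomp_leq HG HF))) => o e.
by rewrite eqn_leq.
Qed.

Lemma ucomp_if (B : seq (nat -> nat) -> seq nat -> bool) (F G : functional) :
  ucomp B -> ucomp F -> ucomp G -> ucomp (fun o e => if B o e then F o e else G o e).
Proof.
move=> HB HF HG; apply: (ucomp_ext (ucomp_case HB HG (ucomp_behead HF))) => o e.
by case: (B o e).
Qed.

Lemma ucomp_pr (F G : functional) : ucomp F -> ucomp G -> ucomp (fun o e => pr (F o e) (G o e)).
Proof.
move=> HF HG.
(* The Cantor pairing of [x] and [y] is [y] plus the triangular number of index [y + x]. This is the
   recursion in its definition, so the two agree by conversion. *)
have HS := ucomp_add (ucomp_succ (ucomp_var 1)) (ucomp_var 0).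
apply: (ucomp_ext (ucomp_add HG (ucomp_rec (ucomp_add HG HF) (ucomp_const 0) HS))) => o e.
by [].
Qed.

(** The bounded quantifier is a product of truth values; in the step, dropping the accumulator
    leaves the index in front of the environment, where [B] expects it. *)
Lemma ucomp_all (B : seq (nat -> nat) -> seq nat -> bool) (N : functional) :
  ucomp B -> ucomp N -> ucomp (fun o e => all (fun k => B o (k :: e)) (iota 0 (N o e))).
Proof.
move=> HB HN; have HS := ucomp_mul (ucomp_var 0) (ucomp_behead HB).
apply: (ucomp_ext (ucomp_rec HN (ucomp_const 1) HS)) => o e /=.
elim: (N o e) => [|n IH] //.
by rewrite -[in RHS]addn1 iotaD all_cat /= andbT add0n IH mulnb.
Qed.

Lemma ucomp_has (B : seq (nat -> nat) -> seq nat -> bool) (N : functional) :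
  ucomp B -> ucomp N -> ucomp (fun o e => has (fun k => B o (k :: e)) (iota 0 (N o e))).
Proof.
move=> HB HN; apply: (ucomp_ext (ucomp_not (ucomp_all (ucomp_not HB) HN))) => o e.
by rewrite -has_predC; congr nat_of_bool; apply: eq_has => k /=; rewrite negbK.
Qed.

Lemma ucomp_teval t : ucomp (fun o e => teval e o t).
Proof.
elim: t => [i|i t IH||t IH|s IHs t IHt|s IHs t IHt|s IHs t IHt] /=.
- exact: ucomp_var.
- exact: ucomp_oracle.
- exact: ucomp_const.
- exact: ucomp_succ.
- exact: ucomp_add.
- exact: ucomp_mul.
- exact: ucomp_pr.
Qed.

Lemma ucomp_sat A : ucomp (fun o e => sat e o A).
Proof.
elim: A => [s t|s t|A IH|A IHA B IHB|A IHA B IHB|A IHA B IHB|t A IH|t A IH] /=.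
- exact: ucomp_eq (ucomp_teval s) (ucomp_teval t).
- exact: ucomp_leq (ucomp_teval s) (ucomp_teval t).
- exact: ucomp_not.
- exact: ucomp_and.
- exact: ucomp_or.
- by apply: (ucomp_ext (ucomp_or (ucomp_not IHA) IHB)) => o e; rewrite implybE.
- exact: ucomp_all IH (ucomp_teval t).
- exact: ucomp_has IH (ucomp_teval t).
Qed.

(** * Computability of the inverse of the Cantor pairing *)

Definition fst_of (q : nat) := (Cantor.of_nat q).1.
Definition snd_of (q : nat) := (Cantor.of_nat q).2.

Lemma of_natE q : Cantor.of_nat q = (fst_of q, snd_of q).
Proof. by rewrite /fst_of /snd_of; case: Cantor.of_nat. Qed.

Lemma prK a b : Cantor.of_nat (pr a b) = (a, b).
Proof. exact: Cantor.cancel_of_to. Qed.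

Lemma fst_pr a b : fst_of (pr a b) = a.
Proof. by rewrite /fst_of prK. Qed.

Lemma snd_pr a b : snd_of (pr a b) = b.
Proof. by rewrite /snd_of prK. Qed.

Lemma pr_eta q : pr (fst_of q) (snd_of q) = q.
Proof. by rewrite /pr -of_natE Cantor.cancel_to_of. Qed.

Lemma leq_snd_of q : snd_of q <= q.
Proof.
have /leP := Cantor.to_nat_non_decreasing (fst_of q) (snd_of q).
by rewrite -/(pr _ _) pr_eta; apply: leq_trans; apply: leq_addr.
Qed.

(** The first component is the least [a] for which some [b] satisfies [pr a b = N]. The search for
    [b] is bounded by [N], since a code is at least its second component. *)
Lemma ucomp_fst (N : functional) : ucomp N -> ucomp (fun o e => fst_of (N o e)).
Proof.
move=> HN.
have HB := ucomp_eq (ucomp_pr (ucomp_var 1) (ucomp_var 0)) (ucomp_behead (ucomp_behead HN)).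
have HF := ucomp_not (ucomp_has HB (ucomp_succ (ucomp_behead HN))).
apply: (ucomp_mu HF) => [o e | o e j lt_j].
  apply/eqP; rewrite eqb0 negbK; apply/hasP; exists (snd_of (N o e)).
    by rewrite mem_iota /= add0n ltnS leq_snd_of.
  by rewrite pr_eta.
rewrite eqb0 negbK; apply/negP=> /hasP[b _ /eqP E].
by move: lt_j; rewrite -E fst_pr ltnn.
Qed.

Lemma ucomp_snd (N : functional) : ucomp N -> ucomp (fun o e => snd_of (N o e)).
Proof.
move=> HN; have HN' := ucomp_behead HN.
have HF := ucomp_not (ucomp_eq (ucomp_pr (ucomp_fst HN') (ucomp_var 0)) HN').
apply: (ucomp_mu HF) => [o e | o e j /= lt_j] /=.
  by rewrite pr_eta eqxx.
rewrite eqb0 negbK; apply/eqP=> E.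
by move: lt_j; rewrite -E snd_pr ltnn.
Qed.

Lemma ucomp_call3 (F N0 N1 N2 : functional) : ucomp F -> ucomp N0 -> ucomp N1 -> ucomp N2 ->
  ucomp (fun o e => F o [:: N0 o e, N1 o e, N2 o e & behead e]).
Proof.
move=> HF H0 H1 H2.
(* Once the three new values are pushed, the old variable 0 sits in position 3; this is the entry
   that is dropped. *)
pose Ge e := [:: nth 0 e 0, nth 0 e 1, nth 0 e 2 & drop 4 e].
have HG : ucomp (fun o e => F o (Ge e)).
  apply: (@ucomp_rename F id (fun i => if i < 3 then i else i.+1) id Ge) => // e.
  by case=> [|[|[|i]]] //=; rewrite nth_drop.
have H01 := ucomp_let (ucomp_let HG (ucomp_behead (ucomp_behead H0))) (ucomp_behead H1).
have H := ucomp_let H01 H2.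
by apply: (ucomp_ext H) => o e; rewrite /= /Ge /= drop1.
Qed.

(** * Eliminating computable oracles *)

Fixpoint Pconst c := if c is c'.+1 then PSucc (Pconst c') else PZero.

Lemma eval_const c o e : eval (Pconst c) o e c.
Proof. by elim: c => //= c IH; exists c. Qed.

(* Closing a program under substitution of constants for its parameters and of
   oracle-free programs for its oracles; the [d] innermost variables are kept. *)
Fixpoint close (Q : nat -> prog) (c : seq nat) (d : nat) (p : prog) : prog :=
  match p with
  | PVar i => if i < d then PVar i else Pconst (nth 0 c (i - d))
  | PZero => PZero
  | PSucc p => PSucc (close Q c d p)
  | POracle i p => PLet (close Q c d p) (Q i)
  | PLet p q => PLet (close Q c d p) (close Q c d.+1 q)
  | PRec p q s => PRec (close Q c d p) (close Q c d q) (close Q c d.+2 s)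
  | PMu p => PMu (close Q c d.+1 p)
  end.

(** The arbitrary tail [e'] says that a closed program reads nothing beyond its kept variables. The
    programs [Q i] need the same property, because an oracle call becomes a [PLet] inside a longer
    environment. *)
Lemma eval_close Q c o p :
  (forall i w e, eval (Q i) [::] (w :: e) (nth zerof o i w)) ->
  forall e e' v, eval p o (e ++ c) v -> eval (close Q c (size e) p) [::] (e ++ e') v.
Proof.
move=> HQ; elim: p => [i||p IH|i p IH|p IHp q IHq|p IHp q IHq s IHs|p IH] e e' v /=.
- move=> ->; rewrite nth_cat; case: ltnP => lt_i /=; first by rewrite nth_cat lt_i.
  exact: eval_const.
- by [].
- by case=> w /IH Hw ->; exists w.
- by case=> w /IH Hw ->; exists w.
- by case=> w /IHp Hw /(IHq (w :: e)) Hv; exists w; last exact: Hv.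
- case=> k /IHp Hk [u [/IHq H0 HS ->]]; exists k; first exact: Hk.
  exists u; split=> //.
  by move=> i /HS/(IHs [:: u i, i & e]); apply.
- case=> /(IH (v :: e)) H0 Hj; split; first exact: H0.
  by move=> j /Hj[w /(IH (j :: e)) Hw]; exists w; apply: Hw.
Qed.

(** This is why a reduction sends instances to instances: the functions of an output instance must
    again be computable without oracles. *)
Lemma computable_ucomp (F : functional) o ns : ucomp F ->
  (forall i, i < size o -> computable (nth zerof o i)) ->
  computable (fun w => F o (w :: ns)).
Proof.
case=> p Hp Ho.
have /functional_choice [Q HQ] : forall i, exists q, forall w e,
    eval q [::] (w :: e) (nth zerof o i w).
  move=> i; case: (ltnP i (size o)) => [/Ho[q Hq] | le_i].
    (* The program [q] is only known to work in the environment [[:: w]]; closing it with no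
       parameters makes it ignore whatever follows [w]. *)
    exists (close (fun=> PZero) [::] 1 q) => w e.
    apply: (@eval_close _ _ [::] q _ [:: w] e) => [j *|]; last exact: Hq.
    by rewrite nth_nil.
  by exists PZero => w e; rewrite nth_default.
exists (close Q ns 1 p) => w.
exact: (@eval_close _ _ o p HQ [:: w] [::]) (Hp _ _).
Qed.

(** * Skolem functions as witnesses *)

Definition AEA := [:: QAll; QEx; QAll].

Definition tuple_fun (Ns Fs : seq functional) (x : tuple_) : tuple_ :=
  Tuple_ [seq N (funs x) (nums x) | N : functional <- Ns]
         [seq fun w => (F : functional) (funs x) (w :: nums x) | F <- Fs].

Definition skolem (phi : formula) (x : tuple_) (s : nat -> nat) :=
  forall n k, sat ([:: n; s n; k] ++ nums x) (funs x) (matrix phi).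

Definition dskolem (phi : formula) (x : tuple_) (n : nat) (s : nat -> nat) :=
  forall m, ~~ sat ([:: n; m; s m] ++ nums x) (funs x) (matrix phi).

Fixpoint all_ucomp (Fs : seq functional) : Prop :=
  if Fs is F :: Fs then ucomp F /\ all_ucomp Fs else True.

(** The innermost part of a witness is the code of the whole tuple, quantified numbers included, so
    a realizer has to be able to produce that code. *)
Lemma ucomp_code (Ms Fs : seq functional) (L : functional) :
  all_ucomp Ms -> all_ucomp Fs -> ucomp L ->
  ucomp (fun o e => code (Tuple_ [seq M o e | M : functional <- Ms]
    [seq fun w => (F : functional) o (w :: e) | F <- Fs]) (L o e)).
Proof.
move=> HM HF; elim: Ms HM L => [|M Ms IH] /= => [_|[HM HMs]] L HL.
  rewrite /code /= /joinf.
  have H : forall I J : functional, ucomp I -> ucomp J ->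
      ucomp (fun o e =>
        nth zerof [seq fun w => (F : functional) o (w :: e) | F <- Fs] (I o e) (J o e)).
    elim: Fs HF => [|F Fs IH] /= => [_|[HF HFs]] I J HI HJ.
      by apply: (ucomp_ext (ucomp_const 0)) => o e; rewrite nth_nil.
    have HI' := IH HFs _ _ (ucomp_pred HI) HJ.
    apply: (ucomp_ext (ucomp_if (ucomp_eq0 HI) (ucomp_let HF HJ) HI')) => o e.
    by case: (I o e).
  apply: (ucomp_ext (H _ _ (ucomp_fst HL) (ucomp_snd HL))) => o e.
  by rewrite of_natE.
apply: (ucomp_ext (ucomp_if (ucomp_eq0 HL) HM (IH HMs _ (ucomp_pred HL)))) => o e.
by rewrite /code /=; case: (L o e).
Qed.

Lemma all_ucomp_map (h : functional -> functional) Fs :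
  (forall F, ucomp F -> ucomp (h F)) -> all_ucomp Fs -> all_ucomp (map h Fs).
Proof. by move=> Hh; elim: Fs => //= F Fs IH [HF /IH HFs]; split=> //; apply: Hh. Qed.

Lemma all_ucomp_cat Fs Gs : all_ucomp Fs -> all_ucomp Gs -> all_ucomp (Fs ++ Gs).
Proof. by move=> HF HG; elim: Fs HF => //= F Fs IH [HF /IH]. Qed.

Lemma ucomp_tuple_code (Ms Ns Fs : seq functional) (L : functional) :
  all_ucomp Ms -> all_ucomp Ns -> all_ucomp Fs -> ucomp L ->
  ucomp (fun o e => let y := tuple_fun Ns Fs (Tuple_ (behead e) (behead o)) in
    code (Tuple_ ([seq M o e | M : functional <- Ms] ++ nums y) (funs y)) (L o e)).
Proof.
move=> HM HN HF HL.
have HN' : all_ucomp [seq (fun o e => (N : functional) (behead o) (behead e)) | N <- Ns].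
  by apply: all_ucomp_map HN => N HN'; exact: (ucomp_obehead (ucomp_behead HN')).
have HF' : all_ucomp
    (* Oracle 0 is the given witness and variable 0 the position queried in the new one, so both are
       hidden from the instance. For [F] the position comes second, after its own argument. *)
    [seq (fun o e => (F : functional) (behead o) (nth 0 e 0 :: behead (behead e)))
       | F <- Fs].
  apply: all_ucomp_map HF => F HF'.
  exact: (ucomp_obehead (ucomp_skip1 HF')).
apply: (ucomp_ext (ucomp_code (all_ucomp_cat HM HN') HF' HL)) => o e /=.
by rewrite map_cat -!map_comp.
Qed.

(** The witness has [S n] at position [pr n 0], and entry [j] of the code of the tuple for [n],
    [S n], [k] at [pr n (pr k j).+1]. The program decodes the position and branches accordingly. *)
Lemma skolem_realizer phi Ns Fs S :
  pattern phi = AEA -> all_ucomp Ns -> all_ucomp Fs -> ucomp S ->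
  exists p, forall a x,
    skolem phi (tuple_fun Ns Fs x) (fun n => S (a :: funs x) (n :: nums x)) ->
    exists2 b, computes p (a :: funs x) (nums x) b & witness phi (tuple_fun Ns Fs x) b.
Proof.
move=> Hphi HN HF HS.
have Hq := ucomp_var 0; have Hj := ucomp_snd Hq; have Hkj := ucomp_pred Hj.
have Hs := ucomp_call HS (ucomp_fst Hq).
have HM : all_ucomp [:: fun _ e => fst_of (nth 0 e 0);
    fun o e => S o (fst_of (nth 0 e 0) :: behead e);
    fun _ e => fst_of (snd_of (nth 0 e 0)).-1].
  exact: (conj (ucomp_fst Hq) (conj Hs (conj (ucomp_fst Hkj) I))).
have [p Hp] := ucomp_if (ucomp_eq0 Hj) Hs (ucomp_tuple_code HM HN HF (ucomp_snd Hkj)).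
exists p => a x Hsk; eexists; first by move=> q; apply: Hp.
move: Hsk; set y := tuple_fun Ns Fs x => Hsk.
rewrite /witness Hphi /= => n k; rewrite /col /tl /= !fst_pr !snd_pr /=.
by split=> [j|]; [rewrite ?(fst_pr, snd_pr) /= ?(fst_pr, snd_pr) | apply: Hsk].
Qed.

(** For the dual pattern the layout is: the number [n] at 0, [S m] at [(pr m 0).+1], and entry [j]
    of the code at [(pr m j.+1).+1]. *)
Lemma dskolem_realizer phi Ns Fs N S :
  pattern phi = AEA -> all_ucomp Ns -> all_ucomp Fs -> ucomp N -> ucomp S ->
  exists p, forall a x,
    dskolem phi (tuple_fun Ns Fs x) (N (a :: funs x) (nums x))
      (fun m => S (a :: funs x) (m :: nums x)) ->
    exists2 b, computes p (a :: funs x) (nums x) b &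
      witness (dual phi) (tuple_fun Ns Fs x) b.
Proof.
move=> Hphi HN HF HN0 HS.
have Hi := ucomp_var 0; have Hq := ucomp_pred Hi.
have Hj := ucomp_snd Hq; have Hkj := ucomp_pred Hj.
have Hs := ucomp_call HS (ucomp_fst Hq); have HN0' := ucomp_behead HN0.
have HM : all_ucomp [:: fun o e => N o (behead e); fun _ e => fst_of (nth 0 e 0).-1;
    fun o e => S o (fst_of (nth 0 e 0).-1 :: behead e)].
  exact: (conj HN0' (conj (ucomp_fst Hq) (conj Hs I))).
have [p Hp] := ucomp_if (ucomp_eq0 Hi) HN0'
  (ucomp_if (ucomp_eq0 Hj) Hs (ucomp_tuple_code HM HN HF Hkj)).
exists p => a x Hsk; eexists; first by move=> q; apply: Hp.
move: Hsk; set y := tuple_fun Ns Fs x => Hsk.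
rewrite /witness /= Hphi /= => m; rewrite /col /tl /= !fst_pr !snd_pr /=.
by split=> [j|]; [rewrite ?(fst_pr, snd_pr) /= ?(fst_pr, snd_pr) | apply: Hsk].
Qed.

Lemma skolem_of_witness phi x a : pattern phi = AEA -> witness phi x a ->
  skolem phi x (fun n => a (pr n 0)).
Proof. by rewrite /witness => -> /= H n k; case: (H n k). Qed.

Lemma dskolem_of_witness phi x a : pattern phi = AEA -> witness (dual phi) x a ->
  dskolem phi x (a 0) (fun m => a (pr m 0).+1).
Proof. by rewrite /witness /= => -> /= H m; case: (H m). Qed.

(** By choice, with no computability required of [a]. The Skolem function has the shape read off
    from a witness, so that one transformation serves both truth and witnesses. *)
Lemma holds_skolem phi x : pattern phi = AEA ->
  holds phi x <-> exists a, skolem phi x (fun n => a (pr n 0)).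
Proof.
rewrite /holds => -> /=; split=> [/functional_choice[s Hs] | [a Ha] n].
  by exists (fun q => s (fst_of q)) => n k; rewrite fst_pr; apply: Hs.
by exists (a (pr n 0)) => k; apply: Ha.
Qed.

Lemma holds_dskolem phi x : pattern phi = AEA ->
  holds (dual phi) x <-> exists a, dskolem phi x (a 0) (fun m => a (pr m 0).+1).
Proof.
rewrite /holds => E; rewrite /= E /=; split=> [[n /functional_choice[s Hs]] | [a Ha]].
  by exists (consf n (fun q => s (fst_of q))) => m; rewrite /= fst_pr; apply: Hs.
by exists (a 0) => m; exists (a (pr m 0).+1); apply: Ha.
Qed.

Lemma computable_tuple_fun D Ns Fs :
  all_ucomp Ns -> all_ucomp Fs -> computable_on D (tuple_fun Ns Fs).
Proof.
have Hprogs (Gs : seq functional) : all_ucomp Gs ->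
    exists ps, size ps = size Gs /\ forall o e i, i < size Gs ->
    eval (nth PZero ps i) o e (nth (fun _ _ => 0) Gs i o e).
  elim: Gs => [|G Gs IH] /=; first by exists [::].
  case=> -[p Hp] /IH[ps [Es Hps]].
  by exists (p :: ps); split=> [|o e [|i] Hi] /=; [rewrite Es | apply: Hp | apply: Hps].
move=> /Hprogs[ps [Eps Hps]] /Hprogs[qs [Eqs Hqs]]; exists ps, qs => x _.
split; rewrite ?size_map ?Eps ?Eqs // => i Hi.
  by rewrite (nth_map (fun _ _ => 0)) //; apply: Hps.
by rewrite (nth_map (fun _ _ => 0)) // => n; apply: Hqs.
Qed.

(** Writing the identity as a [tuple_fun] lets the realizer lemmas also produce witnesses for the
    source instance. *)
Definition id_nums n : seq functional := [seq (fun _ e => nth 0 e i) | i <- iota 0 n].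
Definition id_funs n : seq functional :=
  [seq (fun o e => nth zerof o i (nth 0 e 0)) | i <- iota 0 n].

Lemma all_ucomp_id_nums n : all_ucomp (id_nums n).
Proof.
by rewrite /id_nums; elim: (iota 0 n) => //= i s IH; split=> //; apply: ucomp_var.
Qed.

Lemma all_ucomp_id_funs n : all_ucomp (id_funs n).
Proof.
rewrite /id_funs; elim: (iota 0 n) => //= i s IH; split=> //.
exact: ucomp_oracle (ucomp_var 0).
Qed.

Lemma tuple_fun_id x n m : size (nums x) = n -> size (funs x) = m ->
  tuple_fun (id_nums n) (id_funs m) x = x.
Proof.
case: x => ns fs /= <- <-; rewrite /tuple_fun /= -!map_comp; congr Tuple_.
  exact: (mkseq_nth 0 ns).
exact: (mkseq_nth zerof fs).
Qed.

(** Truth needs no separate hypothesis: the four transformations act on arbitrary functions [a], so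
    they carry the existence of Skolem functions back and forth. *)
Lemma le_dm_skolem (P R : problem) Ns Fs S1 S2 N3 S3 N4 S4 :
  let eta := tuple_fun Ns Fs in
  pattern P = AEA -> pattern R = AEA ->
  all_ucomp Ns -> all_ucomp Fs -> size Ns = nnums R -> size Fs = nfuns R ->
  (forall x, instance_of P x -> promise R (eta x)) ->
  ucomp S1 -> ucomp S2 -> ucomp N3 -> ucomp S3 -> ucomp N4 -> ucomp S4 ->
  (forall x a, instance_of P x -> skolem P x (fun n => a (pr n 0)) ->
     skolem R (eta x) (fun n => S1 (a :: funs x) (n :: nums x))) ->
  (forall x a, instance_of P x -> skolem R (eta x) (fun n => a (pr n 0)) ->
     skolem P x (fun n => S2 (a :: funs x) (n :: nums x))) ->
  (forall x a, instance_of P x -> dskolem P x (a 0) (fun m => a (pr m 0).+1) ->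
     dskolem R (eta x) (N3 (a :: funs x) (nums x)) (fun m => S3 (a :: funs x) (m :: nums x))) ->
  (forall x a, instance_of P x -> dskolem R (eta x) (a 0) (fun m => a (pr m 0).+1) ->
     dskolem P x (N4 (a :: funs x) (nums x)) (fun m => S4 (a :: funs x) (m :: nums x))) ->
  le_dm P R.
Proof.
move=> eta EP ER HN HF SN SF Hprom HS1 HS2 HN3 HS3 HN4 HS4 H1 H2 H3 H4.
have Hinst x : instance_of P x -> instance_of R (eta x).
  move=> Hx; have [Sn Sf Hc _] := Hx; split; rewrite ?size_map //; last exact: Hprom.
  move=> i; rewrite -SF => Hi; rewrite (nth_map (fun _ _ => 0)) //.
  apply: computable_ucomp; last by rewrite Sf.
  by elim: Fs HF i Hi {SF H1 H2 H3 H4 eta Hprom} => // F Fs' IH [HF HFs] [|i] //=; apply: IH.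
have Hid x : instance_of P x -> tuple_fun (id_nums (nnums P)) (id_funs (nfuns P)) x = x.
  by case=> *; apply: tuple_fun_id.
have HidN := all_ucomp_id_nums (nnums P); have HidF := all_ucomp_id_funs (nfuns P).
exists eta; first exact: computable_tuple_fun.
have [p1 Hp1] := skolem_realizer ER HN HF HS1.
have [p2 Hp2] := skolem_realizer EP HidN HidF HS2.
have [p3 Hp3] := dskolem_realizer ER HN HF HN3 HS3.
have [p4 Hp4] := dskolem_realizer EP HidN HidF HN4 HS4.
split; split=> [//|x Hx||].
- rewrite !holds_skolem //; split=> -[a Ha].
    exists (fun q => S1 (a :: funs x) (fst_of q :: nums x)) => n k; rewrite fst_pr.
    exact: H1 Hx Ha n k.
  exists (fun q => S2 (a :: funs x) (fst_of q :: nums x)) => n k; rewrite fst_pr.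
  exact: H2 Hx Ha n k.
- exists p1 => x a Hx Ha; apply: Hp1; apply: H1 => //.
  exact: skolem_of_witness.
- exists p2 => x a Hx Ha; have := Hp2 a x; rewrite Hid //; apply; apply: H2 => //.
  exact: skolem_of_witness.
- rewrite !holds_dskolem //; split=> -[a Ha].
    exists (consf (N3 (a :: funs x) (nums x)) (fun q => S3 (a :: funs x) (fst_of q :: nums x))).
    by move=> m /=; rewrite fst_pr; apply: H3 Hx Ha m.
  exists (consf (N4 (a :: funs x) (nums x)) (fun q => S4 (a :: funs x) (fst_of q :: nums x))).
  by move=> m /=; rewrite fst_pr; apply: H4 Hx Ha m.
- exists p3 => x a Hx Ha; apply: Hp3; apply: H3 => //.
  exact: dskolem_of_witness.
- exists p4 => x a Hx Ha; have := Hp4 a x; rewrite Hid //; apply; apply: H4 => //.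
  exact: dskolem_of_witness.
Qed.

(** * The universal formula *)

Definition universal : formula :=
  Formula AEA 0 1 (BEq (TApp 0 (TPair (TVar 0) (TPair (TVar 1) (TVar 2)))) TZero).

(** The truth value of the matrix is tabulated as a function that is 0 where the matrix holds, so
    Skolem functions carry over unchanged. Allowing restricted problems covers the reduction of
    [Compl] as well. *)
Lemma le_dm_universal (P : problem) : pattern P = AEA -> le_dm P (unrestricted universal).
Proof.
move=> EP; have Hq := ucomp_var 0; have Hq2 := ucomp_snd Hq.
pose Fm : functional := fun o e => ~~ sat
  [:: fst_of (nth 0 e 0), fst_of (snd_of (nth 0 e 0)), snd_of (snd_of (nth 0 e 0)) & behead e]
  o (matrix P).
have HFm : ucomp Fm.
  by apply: ucomp_not;
    apply: (ucomp_call3 (ucomp_sat _) (ucomp_fst Hq) (ucomp_fst Hq2) (ucomp_snd Hq2)).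
have HS : ucomp (fun o e => nth zerof o 0 (pr (nth 0 e 0) 0)).
  exact: ucomp_oracle (ucomp_pr Hq (ucomp_const 0)).
have HS' : ucomp (fun o e => nth zerof o 0 (pr (nth 0 e 0) 0).+1).
  exact: ucomp_oracle (ucomp_succ (ucomp_pr Hq (ucomp_const 0))).
have HN : ucomp (fun o _ => nth zerof o 0 0) := ucomp_oracle 0 (ucomp_const 0).
have Esat x n m k : sat [:: n; m; k] (funs (tuple_fun [::] [:: Fm] x)) (matrix universal) =
    sat [:: n, m, k & nums x] (funs x) (matrix P).
  by rewrite /= /Fm /= !(fst_pr, snd_pr) eqb0 negbK.
apply: (@le_dm_skolem _ _ [::] [:: Fm] _ _ _ _ _ _ EP _ _ _ _ _ _ HS HS HN HS' HN HS') => //.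
- by move=> x a _ Ha n k; rewrite cats0 Esat; apply: Ha.
- by move=> x a _ Ha n k; have := Ha n k; rewrite cats0 Esat.
- by move=> x a _ Ha m; rewrite cats0 Esat; apply: Ha.
- by move=> x a _ Ha m; have := Ha m; rewrite cats0 Esat.
Qed.

(** * The poset of an instance *)

(* The first index of [C] and that of [H] only produce duplicates of an element:
   with them, [enc] below is a bijection onto [nat], so no junk codes arise. *)
Inductive elt :=
| Bot | Top | E | F | G
| H of nat
| A of nat
| B of nat & nat
| C of nat & nat & nat & nat.

(** The order does not depend on the instance; only membership of the elements [C] does. That
    [C _ n m _] lies below [E], [F] and all [B n' m'] with [n'] distinct from [n] is forced by
    transitivity through [A n]. *)
Definition le_elt (a b : elt) : bool :=
  match a, b with
  | Bot, _ | _, Top => true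
  | E, E | F, F | G, G | G, E => true
  | H i, H i' => i == i'
  | H _, F => true
  | A n, A n' => n == n'
  | A _, E | A _, F => true
  | A n, B n' _ => n != n'
  | B n m, B n' m' => (n == n') && (m == m')
  | C j n m k, C j' n' m' k' => [&& j == j', n == n', m == m' & k == k']
  | C _ n _ _, A n' => n == n'
  | C _ _ _ _, E | C _ _ _ _, F => true
  | C _ n m _, B n' m' => (n != n') || (m == m')
  | _, _ => false
  end.

Definition in_elt (f : nat -> nat) (a : elt) : bool :=
  if a is C _ n m k then f (pr n (pr m k)) != 0 else true.

Definition is_top a := if a is Top then true else false.
Definition is_bot a := if a is Bot then true else false.

Definition common_bound (a b c : elt) : bool :=
  [&& le_elt a c, le_elt b c & ~~ is_top c] || [&& ~~ is_bot c, le_elt c a & le_elt c b].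

Lemma le_elt_refl a : le_elt a a.
Proof. by case: a => *; rewrite /= ?eqxx. Qed.

Lemma le_elt_anti a b : le_elt a b -> le_elt b a -> a = b.
Proof.
case: a b => [|||||i|n|n m|j n m k] [|||||i'|n'|n' m'|j' n' m' k'] //=.
- by move/eqP->.
- by move/eqP->.
- by case/andP=> /eqP-> /eqP->.
- by case/and4P=> /eqP-> /eqP-> /eqP-> /eqP->.
Qed.

Lemma le_elt_trans a b c : le_elt a b -> le_elt b c -> le_elt a c.
Proof.
case: a b => [|||||i|n|n m|j n m k] [|||||i'|n'|n' m'|j' n' m' k'] //;
  case: c => [|||||i''|n''|n'' m''|j'' n'' m'' k''] //=; lia.
Qed.

(** The function [t] matters only at the elements [A n]. The index [m.+1] can be any number other
    than [m], since [C _ n m _] lies below [B n m'] only for [m' = m]. *)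
Definition complement (t : nat -> nat) (a : elt) : elt :=
  match a with
  | Bot => Top
  | Top => Bot
  | E => H 0
  | F => G
  | G => F
  | H _ => E
  | A n => B n (t n)
  | B _ _ => G
  | C _ n m _ => B n m.+1
  end.

Lemma complementP f t a c :
  (forall n, a = A n -> forall k, f (pr n (pr (t n) k)) == 0) ->
  in_elt f c -> ~~ common_bound a (complement t a) c.
Proof.
rewrite /common_bound.
case: a => [|||||i|n|n m|j n m k]; case: c => [|||||i'|n'|n' m'|j' n' m' k'] //= Ha;
  try by move=> _; lia.
(* What remains is [a = A n] against an element [C]: being a common lower bound would make it a
   [C _ n (t n) k], whose presence contradicts the vanishing of [f]. *)
move=> f0; apply/negP=> /andP[/eqP En]; rewrite En eqxx /= => /eqP Em.
by move: f0; rewrite En Em Ha.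
Qed.

Lemma complement_in f t a : in_elt f (complement t a).
Proof. by case: a. Qed.

(** A refutation of each candidate [b] for a complement of [A n]. Only the candidates [B n m] need
    information on the instance, namely a [k] from [t m]. *)
Definition spoiler n (t : nat -> nat) (b : elt) : elt :=
  match b with
  | Bot | Top | E | F => A n
  | G | A _ | C _ _ _ _ => E
  | H _ => F
  | B n' m => if n' == n then C 0 n m (t m) else A n
  end.

Lemma spoiler_in f n t b : (forall m, f (pr n (pr m (t m))) != 0) -> in_elt f (spoiler n t b).
Proof. by move=> Ht; case: b => //= n' m; case: ifP => //= _; apply: Ht. Qed.

Lemma spoilerP n t b : common_bound (A n) b (spoiler n t b).
Proof.
case: b => [|||||i|n'|n' m|j n' m k] //; rewrite /common_bound /= ?eqxx //.
by case: (eqVneq n' n) => [->|ne] /=; rewrite ?eqxx ?orbT //= eq_sym ne.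
Qed.

Lemma complement_of_A f n b :
  (forall c, in_elt f c -> ~~ common_bound (A n) b c) -> exists m, b = B n m.
Proof.
(* The choice of [id] is arbitrary: [t] is consulted only when [b] already has the desired form. *)
move=> Hb; pose c := spoiler n id b.
case: b @c Hb => [|||||i|n'|n' m|j n' m k] c Hb.
all: try by have := Hb c isT; rewrite spoilerP.
case: (eqVneq n' n) => [->|ne]; first by exists m.
by have := Hb c; rewrite spoilerP /c /= (negbTE ne) => /(_ isT).
Qed.

Lemma common_bound_AB n m c : common_bound (A n) (B n m) c -> exists j k, c = C j n m k.
Proof.
rewrite /common_bound.
case: c => [|||||i|n'|n' m'|j n' m' k] //=; try by move=> ?; exfalso; lia.
by move=> ?; exists j, k; congr C; lia.
Qed.

(** * Numbering the elements *)

Definition enc (a : elt) : nat :=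
  match a with
  | Bot => pr 0 0
  | Top => pr 0 1
  | E => pr 0 2
  | F => pr 0 3
  | G => pr 0 4
  | H i => pr 0 i.+4.+1
  | A n => pr 1 n
  | B n m => pr 2 (pr n m)
  | C j n m k => pr j.+3 (pr n (pr m k))
  end.

Definition dec (u : nat) : elt :=
  let p := snd_of u in
  match fst_of u with
  | 0 => match p with 0 => Bot | 1 => Top | 2 => E | 3 => F | 4 => G | i.+4.+1 => H i end
  | 1 => A p
  | 2 => B (fst_of p) (snd_of p)
  | j.+3 => C j (fst_of p) (fst_of (snd_of p)) (snd_of (snd_of p))
  end.

Lemma encK : cancel enc dec.
Proof. by case=> *; rewrite /dec ?(fst_pr, snd_pr). Qed.

Lemma decK : cancel dec enc.
Proof.
move=> u; rewrite -{2}(pr_eta u) /dec.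
case: (fst_of u) => [|[|[|j]]] /=; rewrite ?pr_eta //.
by case: (snd_of u) => [|[|[|[|[|i]]]]].
Qed.

Lemma eq_enc_top u : (u == enc Top) = is_top (dec u).
Proof.
by rewrite -{1}(decK u); apply/eqP/idP=> [/(can_inj encK)->|]; case: (dec u).
Qed.

Lemma eq_enc_bot u : (enc Bot == u) = is_bot (dec u).
Proof.
by rewrite -{1}(decK u); apply/eqP/idP=> [/(can_inj encK)<-|]; case: (dec u).
Qed.

Definition carrier_char (f : nat -> nat) (u : nat) : nat := in_elt f (dec u).
Definition order_char (f : nat -> nat) (q : nat) : nat :=
  [&& in_elt f (dec (fst_of q)), in_elt f (dec (snd_of q))
    & le_elt (dec (fst_of q)) (dec (snd_of q))].

Lemma order_charE f u v : (order_char f (pr u v) == 1) =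
  [&& in_elt f (dec u), in_elt f (dec v) & le_elt (dec u) (dec v)].
Proof. by rewrite /order_char fst_pr snd_pr eqb1. Qed.

Lemma order_bounded f : bounded_poset (enc Top) (enc Bot) (carrier_char f) (order_char f).
Proof.
have orderP u v : order_char f (pr u v) = 1 <->
    [/\ in_elt f (dec u), in_elt f (dec v) & le_elt (dec u) (dec v)].
  by split=> [/eqP|?]; [|apply/eqP]; rewrite order_charE; apply/and3P.
have carrierP u : carrier_char f u = 1 <-> in_elt f (dec u).
  by rewrite /carrier_char; case: in_elt.
split.
- by move=> u; apply: leq_b1.
- by move=> u; apply: leq_b1.
- by move=> u v /orderP[]; rewrite !carrierP.
- by move=> u /carrierP Hu; apply/orderP; rewrite le_elt_refl.
- move=> u v /orderP[_ _ Huv] /orderP[_ _ Hvu].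
  exact: (can_inj decK) (le_elt_anti Huv Hvu).
- move=> u v w /orderP[Hu _ Huv] /orderP[_ Hw Hvw]; apply/orderP; split=> //.
  exact: le_elt_trans Huv Hvw.
- by rewrite carrierP encK.
- by rewrite carrierP encK.
- by move=> u /carrierP Hu; apply/orderP; rewrite encK; split=> //; case: (dec u).
- by move=> u /carrierP Hu; apply/orderP; rewrite encK.
Qed.

(** This moves the matrix from codes to [elt]. The membership tests inside the coded order are
    absorbed by the guards on the three quantified elements. *)
Lemma sat_compl f u w v :
  sat [:: u; w; v; enc Top; enc Bot] [:: carrier_char f; order_char f] compl_matrix =
  (in_elt f (dec u) ==> in_elt f (dec w) &&
    (in_elt f (dec v) ==> ~~ common_bound (dec u) (dec w) (dec v))).
Proof.
have le_top : le_elt (dec v) Top by case: (dec v).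
rewrite /= !order_charE /carrier_char eq_enc_top eq_enc_bot !eqb1.
rewrite -[pr 0 0]/(enc Bot) -[pr 0 1]/(enc Top) !encK le_top.
rewrite /common_bound.
case: (in_elt f (dec u)) (in_elt f (dec w)) (in_elt f (dec v)) => [] [] [] //=.
by rewrite -andbA.
Qed.

(** * Computability of the reduction *)

(** Functionals take values in [nat], so elements are handled through a constructor number and four
    coordinates, set to 0 where absent. *)
Definition kind a :=
  match a with
  | Bot => 0 | Top => 1 | E => 2 | F => 3 | G => 4 | H _ => 5 | A _ => 6 | B _ _ => 7
  | C _ _ _ _ => 8
  end.
Definition ix a := match a with H i => i | C j _ _ _ => j | _ => 0 end.
Definition ix_n a := match a with A n | B n _ | C _ n _ _ => n | _ => 0 end.
Definition ix_m a := match a with B _ m | C _ _ m _ => m | _ => 0 end.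
Definition ix_k a := if a is C _ _ _ k then k else 0.

Ltac ucomp_solve :=
  repeat first
    [ eassumption
    | exact: ucomp_const
    | exact: ucomp_var
    | refine (ucomp_fst _)
    | refine (ucomp_snd _)
    | refine (ucomp_not _)
    | refine (ucomp_and _ _)
    | refine (ucomp_or _ _)
    | refine (ucomp_eq _ _)
    | refine (ucomp_leq _ _)
    | refine (ucomp_pr _ _)
    | refine (ucomp_oracle _ _)
    | refine (ucomp_sub _ _)
    | refine (ucomp_add _ _)
    | refine (ucomp_succ _)
    | refine (ucomp_if _ _ _) ].

Lemma ucomp_kind (N : functional) : ucomp N -> ucomp (fun o e => kind (dec (N o e))).
Proof.
move=> HN.
have HF : ucomp (fun o e => if fst_of (N o e) == 0 then
    (if snd_of (N o e) <= 5 then snd_of (N o e) else 5)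
  else if fst_of (N o e) <= 2 then fst_of (N o e) + 5 else 8) by ucomp_solve.
apply: (ucomp_ext HF) => o e; rewrite /dec.
case: (fst_of _) => [|[|[|j]]] //=.
by case: (snd_of _) => [|[|[|[|[|[|i]]]]]].
Qed.

Lemma ucomp_ix (N : functional) : ucomp N -> ucomp (fun o e => ix (dec (N o e))).
Proof.
move=> HN.
have HF : ucomp (fun o e =>
  if fst_of (N o e) == 0 then snd_of (N o e) - 5 else fst_of (N o e) - 3) by ucomp_solve.
apply: (ucomp_ext HF) => o e; rewrite /dec.
case: (fst_of _) => [|[|[|j]]] //=; last by rewrite !subSS subn0.
by case: (snd_of _) => [|[|[|[|[|i]]]]] //=; rewrite !subSS subn0.
Qed.

Lemma ucomp_ix_n (N : functional) : ucomp N -> ucomp (fun o e => ix_n (dec (N o e))).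
Proof.
move=> HN.
have HF : ucomp (fun o e => if fst_of (N o e) == 0 then 0 else
  if fst_of (N o e) == 1 then snd_of (N o e) else fst_of (snd_of (N o e))) by ucomp_solve.
apply: (ucomp_ext HF) => o e; rewrite /dec.
case: (fst_of _) => [|[|[|j]]] //=.
by case: (snd_of _) => [|[|[|[|[|i]]]]].
Qed.

Lemma ucomp_ix_m (N : functional) : ucomp N -> ucomp (fun o e => ix_m (dec (N o e))).
Proof.
move=> HN.
have HF : ucomp (fun o e => if fst_of (N o e) <= 1 then 0 else
  if fst_of (N o e) == 2 then snd_of (snd_of (N o e))
  else fst_of (snd_of (snd_of (N o e)))) by ucomp_solve.
apply: (ucomp_ext HF) => o e; rewrite /dec.
case: (fst_of _) => [|[|[|j]]] //=.
by case: (snd_of _) => [|[|[|[|[|i]]]]].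
Qed.

Lemma ucomp_ix_k (N : functional) : ucomp N -> ucomp (fun o e => ix_k (dec (N o e))).
Proof.
move=> HN.
have HF : ucomp (fun o e => if fst_of (N o e) <= 2 then 0 else
  snd_of (snd_of (snd_of (N o e)))) by ucomp_solve.
apply: (ucomp_ext HF) => o e; rewrite /dec.
case: (fst_of _) => [|[|[|j]]] //=.
by case: (snd_of _) => [|[|[|[|[|i]]]]].
Qed.

(** An arithmetical form of the order, fit for the closure lemmas. Since absent coordinates are 0,
    equality of elements is equality of all coordinates. *)
Lemma le_eltE a b : le_elt a b =
  let x := kind a in let y := kind b in
  [|| x == 0, y == 1,
    [&& x == y, ix a == ix b, ix_n a == ix_n b, ix_m a == ix_m b & ix_k a == ix_k b],
    (x == 4) && (y == 2), (x == 5) && (y == 3),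
    (x == 6) && [|| y == 2, y == 3 | (y == 7) && (ix_n a != ix_n b)]
  | (x == 8) && [|| y == 2, y == 3, (y == 6) && (ix_n a == ix_n b)
                  | (y == 7) && ((ix_n a != ix_n b) || (ix_m a == ix_m b))]].
Proof.
by case: a b => [|||||i|n|n m|j n m k] [|||||i'|n'|n' m'|j' n' m' k'] //=;
  rewrite ?andbT ?orbF.
Qed.

Lemma ucomp_le_elt (N M : functional) : ucomp N -> ucomp M ->
  ucomp (fun o e => le_elt (dec (N o e)) (dec (M o e))).
Proof.
move=> HN HM.
have [HkN HkM] := (ucomp_kind HN, ucomp_kind HM).
have [HiN HiM] := (ucomp_ix HN, ucomp_ix HM).
have [HnN HnM] := (ucomp_ix_n HN, ucomp_ix_n HM).
have [HmN HmM] := (ucomp_ix_m HN, ucomp_ix_m HM).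
have [HN' HM'] := (ucomp_ix_k HN, ucomp_ix_k HM).
(* The computable functional stays a metavariable until the rewriting fills it in. *)
eapply ucomp_ext; last by move=> o e; rewrite le_eltE /=; reflexivity.
by ucomp_solve.
Qed.

Lemma ucomp_in_elt (N : functional) :
  ucomp N -> ucomp (fun o e => in_elt (nth zerof o 0) (dec (N o e))).
Proof.
move=> HN.
have [Hk Hn Hm HK] := And4 (ucomp_kind HN) (ucomp_ix_n HN) (ucomp_ix_m HN) (ucomp_ix_k HN).
have HF : ucomp (fun o e => (kind (dec (N o e)) != 8) || (nth zerof o 0
  (pr (ix_n (dec (N o e))) (pr (ix_m (dec (N o e))) (ix_k (dec (N o e))))) != 0)) by ucomp_solve.
by apply: (ucomp_ext HF) => o e; case: (dec _).
Qed.

Lemma ucomp_complement : ucomp (fun o e =>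
  enc (complement (fun n => nth zerof o 0 (pr n 0)) (dec (nth 0 e 0)))).
Proof.
have HN := ucomp_var 0.
have [Hk Hn Hm HK] := And4 (ucomp_kind HN) (ucomp_ix_n HN) (ucomp_ix_m HN) (ucomp_ix_k HN).
have HF : ucomp (fun o e => let a := dec (nth 0 e 0) in
  if kind a == 0 then enc Top else if kind a == 1 then enc Bot else
  if kind a == 2 then enc (H 0) else if kind a == 3 then enc G else
  if kind a == 4 then enc F else if kind a == 5 then enc E else
  if kind a == 6 then pr 2 (pr (ix_n a) (nth zerof o 0 (pr (ix_n a) 0))) else
  if kind a == 7 then enc G else pr 2 (pr (ix_n a) (ix_m a).+1)) by ucomp_solve.
by apply: (ucomp_ext HF) => o e /=; case: (dec _).
Qed.

Lemma ucomp_spoiler : ucomp (fun o e =>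
  enc (spoiler (nth zerof o 0 0) (fun m => nth zerof o 0 (pr m 0).+1) (dec (nth 0 e 0)))).
Proof.
have HN := ucomp_var 0.
have [Hk Hn Hm HK] := And4 (ucomp_kind HN) (ucomp_ix_n HN) (ucomp_ix_m HN) (ucomp_ix_k HN).
have HF : ucomp (fun o e => let a := dec (nth 0 e 0) in let n := nth zerof o 0 0 in
  if kind a <= 3 then pr 1 n else if kind a == 5 then enc F else
  if kind a == 7 then
    (if ix_n a == n then pr 3 (pr n (pr (ix_m a) (nth zerof o 0 (pr (ix_m a) 0).+1))) else pr 1 n)
  else enc E) by ucomp_solve.
apply: (ucomp_ext HF) => o e /=; case: (dec _) => //= n m.
by case: eqP.
Qed.

Lemma ucomp_carrier_char : ucomp (fun o e => carrier_char (nth zerof o 0) (nth 0 e 0)).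
Proof. exact: ucomp_in_elt (ucomp_var 0). Qed.

Lemma ucomp_order_char : ucomp (fun o e => order_char (nth zerof o 0) (nth 0 e 0)).
Proof.
have [H1 H2] := (ucomp_fst (ucomp_var 0), ucomp_snd (ucomp_var 0)).
exact: ucomp_and (ucomp_in_elt H1) (ucomp_and (ucomp_in_elt H2) (ucomp_le_elt H1 H2)).
Qed.

(** * Reduction of the universal formula to [Compl] *)

Lemma universal_le_dm_Compl : le_dm (unrestricted universal) Compl.
Proof.
have Htop : ucomp (fun _ _ => enc Top) := ucomp_const _.
have Hbot : ucomp (fun _ _ => enc Bot) := ucomp_const _.
have H0 : ucomp (fun o _ => nth zerof o 0 0) := ucomp_oracle 0 (ucomp_const 0).
have Hq := ucomp_var 0.
(* Given complements, [m] is read off from the complement [B n m] of [A n], whose code is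
   [pr 1 n]. *)
have HS2 : ucomp (fun o e => ix_m (dec (nth zerof o 0 (pr (pr 1 (nth 0 e 0)) 0)))).
  by apply: ucomp_ix_m; ucomp_solve.
have HN3 : ucomp (fun o _ => pr 1 (nth zerof o 0 0)) by ucomp_solve.
have HN4 := ucomp_ix_n H0.
(* Given an element [A n] without complement, the candidate [B n m] is submitted, and [k] is read
   off from the common lower bound returned. *)
have HS4 : ucomp (fun o e => ix_k (dec (nth zerof o 0
    (pr (pr 2 (pr (ix_n (dec (nth zerof o 0 0))) (nth 0 e 0))) 0).+1))).
  by apply: ucomp_ix_k; ucomp_solve.
apply: (@le_dm_skolem (unrestricted universal) Compl [:: _; _] [:: _; _] _ _ _ _ _ _
  (erefl _) (erefl _) (conj Htop (conj Hbot I))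
  (conj ucomp_carrier_char (conj ucomp_order_char I)) (erefl _) (erefl _) _
  ucomp_complement HS2 HN3 ucomp_spoiler HN4 HS4).
- by case=> ns fs _; apply: order_bounded.
all: case=> ns fs a [/= /size0nil -> Sf _ _]; case: fs Sf => [|f [|]] //= _.
- move=> Ha u v; rewrite [sat _ _ _](sat_compl f u _ v) encK complement_in.
  apply/implyP=> _; apply/implyP; apply: complementP => n _ k.
  exact: Ha n k.
- move=> Ha n k; pose b := dec (a (pr (enc (A n)) 0)).
  have HA c : in_elt f b && (in_elt f c ==> ~~ common_bound (A n) b c).
    by have := Ha (enc (A n)) (enc c); rewrite [sat _ _ _](sat_compl f _ _ _) !encK.
  have [c|m Eb] := @complement_of_A f n b; first by apply/implyP; case/andP: (HA c).
  (* This [C] would be a nonzero common lower bound of [A n] and its complement, so it is absent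
     from the poset, which means that [f] vanishes there. *)
  have := HA (C 0 n m k); rewrite Eb /common_bound /= !eqxx orbT implybF negbK.
  by rewrite -/(enc (A n)) -/b Eb.
- move=> Ha u; rewrite [sat _ _ _](sat_compl f _ _ _) !encK -[dec (pr 1 _)]/(dec (enc (A _))) encK.
  by rewrite spoilerP spoiler_in /= ?andbF // => m; apply: Ha m.
- move=> Ha m.
  have Hb b : ~~ (in_elt f (dec (a 0)) ==> in_elt f b &&
      (in_elt f (dec (a (pr (enc b) 0).+1)) ==>
        ~~ common_bound (dec (a 0)) b (dec (a (pr (enc b) 0).+1)))).
    by have := Ha (enc b); rewrite [sat _ _ _](sat_compl f _ _ _) encK.
  (* Every element not of the form [A n] has a complement whatever [f] is; submitting that
     complement to the alleged counterexample gives a contradiction. *)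
  have [n En] : exists n, dec (a 0) = A n.
    have := Hb (complement id (dec (a 0))).
    rewrite negb_imply complement_in /= negb_imply negbK => /and3P[_ Hc Hbad].
    by case Ea : (dec (a 0)) => [|||||i|n|n m'|j n m' k]; first [by exists n |
      by move: Hbad; rewrite (negbTE (complementP _ Hc)) // Ea].
  have := Hb (B n m); rewrite En /= negb_imply negbK => /andP[Hc /common_bound_AB[j [k Ek]]].
  by move: Hc; rewrite Ek.
Qed.

Theorem theorem3p15 : dicomplete [:: QAll; QEx; QAll] Compl.
Proof.
exists universal.
  by split=> // psi Epsi; apply: le_dm_universal.
by split; [apply: le_dm_universal | apply: universal_le_dm_Compl].
Qed.
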